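(* Let $\mathcal{C},\mathcal{C}'$ be conjugacy classes of $S_n$ whose elements have $c_j$ (resp. $c'_j$) $j$-cycles, with $c=\sum_jc_j$, $c'=\sum_jc'_j$. Let $\pi\in\mathcal{C}$, $\pi'\in\mathcal{C}'$ be independent and uniform, and let $N_i$ be the number of orbits of size $i$ of $\langle\pi,\pi'\rangle$ on $\{1,\dots,n\}$. Let \[ B=\max\{(c_1+c^{1/2})(c'_1+{c'}^{1/2})/n,\,1\},\qquad D=\min\{c_1+c^{1/2},\,c'_1+{c'}^{1/2}\}. \] Then for all integers $k\geq1$ and $m_1,\dots,m_k\geq0$, writing $M=m_1\cdot1+\cdots+m_k\cdot k$, there is a constant $C_M$ depending only on $M$ such that \[ \left|\mathbf{E}[(N_1)_{m_1}\cdots(N_k)_{m_k}]-(\mathbf{E}N_1)^{m_1}\cdots(\mathbf{E}N_k)^{m_k}\right|\leq C_M\frac{B^M}{D^{2/3}} \] for all $n$ and all such classes. Also, for all $k,m\geq1$, with $N_{\leq k}=N_1+\cdots+N_k$, there is a constant $C_{k,m}$ depending only on $k,m$ such that \[ \left|\mathbf{E}[(N_{\leq k})_m]-(\mathbf{E}N_{\leq k})^m\right|\leq C_{k,m}\frac{B^{km}}{D^{2/3}}. \]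
   Context: $(x)_r=x(x-1)\cdots(x-r+1)$ denotes the falling factorial. *)

(* Defs.v *)
From HB Require Import structures.
From mathcomp Require Import all_boot all_order all_algebra all_fingroup.
From mathcomp Require Import all_classical all_reals.
From mathcomp Require Import exp.
Set Implicit Arguments. Unset Strict Implicit. Unset Printing Implicit Defensive.
Import Order.TTheory GRing.Theory Num.Theory.
Local Open Scope ring_scope.

Definition conj_class (n : nat) (s0 : {perm 'I_n}) : {set {perm 'I_n}} :=
  (s0 ^: [set: {perm 'I_n}])%g.

Definition cycle_count (n : nat) (s : {perm 'I_n}) (j : nat) : nat :=
  #|[set O in porbits s | #|O| == j]|.

Definition total_cycles (n : nat) (s : {perm 'I_n}) : nat := #|porbits s|.

Definition gen_orbits (n : nat) (s t : {perm 'I_n}) : {set {set 'I_n}} :=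
  [set orbit 'P <<[set s; t]>>%g x | x : 'I_n].

Definition Norb (n : nat) (s t : {perm 'I_n}) (i : nat) : nat :=
  #|[set O in gen_orbits s t | #|O| == i]|.

Definition Epair (R : realType) (n : nat) (C C' : {set {perm 'I_n}})
  (f : {perm 'I_n} -> {perm 'I_n} -> R) : R :=
  (\sum_(s in C) \sum_(t in C') f s t) / (#|C| * #|C'|)%:R.

Definition cterm (R : realType) (n : nat) (s : {perm 'I_n}) : R :=
  (cycle_count s 1)%:R + Num.sqrt ((total_cycles s)%:R).

Definition Bconst (R : realType) (n : nat) (s0 t0 : {perm 'I_n}) : R :=
  Num.max (cterm R s0 * cterm R t0 / n%:R) 1.

Definition Dconst (R : realType) (n : nat) (s0 t0 : {perm 'I_n}) : R :=
  Num.min (cterm R s0) (cterm R t0).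

(* Main.v *)
Require Import Defs.
From HB Require Import structures.
From mathcomp Require Import all_classical all_reals exp.
From mathcomp Require Import all_boot all_order all_algebra all_fingroup.
From mathcomp Require Import primitive_action alt.
From mathcomp Require Import zify ring lra.
Import Order.TTheory GRing.Theory Num.Theory.
Set Implicit Arguments. Unset Strict Implicit. Unset Printing Implicit Defensive.
Local Open Scope ring_scope.

(* For a finite set [V] with a map [f], let [emb f pi] be the number of
   injections [phi : V -> [n]] with [pi phi = phi f].  Since conjugation moves
   any injection to any other, a uniform [pi] in its class satisfies
   [pi phi = phi f] with probability [emb f pi / (n)_|V|], for each [phi].  A
   tuple of distinct orbits of <pi, pi'> is, up to labelling, such an injection
   for a pair [(f, f')] acting transitively on each block of [V], so its
   expected number is a sum of terms [emb f pi * emb f' pi' / (n)_|V|].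

   With [T = c_1 + c^(1/2)], the number of pi-invariant sets of size [k] is at
   most [T^k], by removing one cycle at a time; hence [emb f pi = O(T^|V|)].
   For a disjoint union of [f] on [V] and [g] on [W], the count [emb] is
   [emb f * emb g] minus the number of pairs of embeddings with intersecting
   images; such a pair shares a cycle, which makes their number
   [O(T^(|V| + |W| - 1))].  As moreover [1/(n)_(v + w)] differs from
   [1/((n)_v (n)_w)] by a relative error [O(1/n) = O(1/D)], adding one orbit to
   the tuple costs an error [O(B^(v + w) / D)].  This gives the theorem with
   [D] instead of [D^(2/3)]. *)

(** * Embeddings of self-maps and averaging over a conjugacy class *)

Section Embeddings.
Context {V T : finType}.
Implicit Types (f : {ffun V -> V}) (s g : {perm T}) (phi psi : {ffun V -> T}).

Definition equivariant f s phi := [forall x, s (phi x) == phi (f x)].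

Definition embeddings f s : {set {ffun V -> T}} :=
  [set phi : {ffun V -> T} | injectiveb phi && equivariant f s phi].

Lemma equivariantP f s phi :
  reflect (forall x, s (phi x) = phi (f x)) (equivariant f s phi).
Proof. by apply: (iffP forallP) => h x; apply/eqP. Qed.

(** The symmetric group on [T] is [#|V|]-transitive, and the values of an injection form a tuple of
    distinct points. *)
Lemma extend_perm phi psi : injective phi -> injective psi ->
  exists g : {perm T}, forall x, psi x = g (phi x).
Proof.
move=> iphi ipsi.
have le : (#|V| <= #|T|)%N by apply: leq_card iphi.
have tr := ntransitive_weak le (Sym_trans T).
have dt (chi : {ffun V -> T}) : injective chi ->
    [tuple chi (enum_val i) | i < #|V|] \in #|V|.-dtuple([set: T]).
  move=> ichi; apply/dtuple_onP; split=> [i j|i]; last by rewrite inE.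
  by rewrite !tnth_mktuple => /ichi /enum_val_inj.
have [g _ eg] := atransP2 tr (dt _ iphi) (dt _ ipsi).
exists g => x; have := congr1 (fun t => tnth t (enum_rank x)) eg.
by rewrite [RHS]tnth_map !tnth_mktuple enum_rankK.
Qed.

Lemma equivariant_conj f s g phi :
  equivariant f (s ^ g)%g [ffun x => g (phi x)] = equivariant f s phi.
Proof.
apply/equivariantP/equivariantP => h x; have := h x; rewrite ?ffunE permJ.
  exact: perm_inj.
by move=> ->.
Qed.

Lemma leq_card_embeddings_conj f s g :
  (#|embeddings f s| <= #|embeddings f (s ^ g)%g|)%N.
Proof.
pose F phi : {ffun V -> T} := [ffun x => g (phi x)].
have Finj : injective F.
  move=> phi psi /ffunP e; apply/ffunP => x; have := e x; rewrite !ffunE.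
  exact: perm_inj.
rewrite -(card_imset _ Finj); apply: subset_leq_card.
apply/subsetP => _ /imsetP[phi + ->]; rewrite !inE equivariant_conj.
move=> /andP[/injectiveP iphi ->]; rewrite andbT; apply/injectiveP => x y.
by rewrite !ffunE => /perm_inj /iphi.
Qed.

Lemma card_embeddings_conj f s g :
  #|embeddings f (s ^ g)%g| = #|embeddings f s|.
Proof.
apply/eqP; rewrite eqn_leq leq_card_embeddings_conj andbT.
by rewrite -{2}[s](conjgK g) leq_card_embeddings_conj.
Qed.

(** Conjugation by a permutation carrying [phi] to [psi] injects the first set into the second. *)
Lemma leq_card_class_equivariant f s0 phi psi : injective phi -> injective psi ->
  (#|[set s in s0 ^: [set: {perm T}] | equivariant f s phi]%g|
   <= #|[set s in s0 ^: [set: {perm T}] | equivariant f s psi]%g|)%N.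
Proof.
move=> iphi ipsi; have [g eg] := extend_perm iphi ipsi.
rewrite -(card_imset _ (conjg_inj g)); apply: subset_leq_card.
apply/subsetP => _ /imsetP[s + ->]; rewrite !inE => /andP[sC es].
apply/andP; split.
  by case/imsetP: sC => y _ ->; rewrite -conjgM memJ_class ?inE.
suff -> : psi = [ffun x => g (phi x)] by rewrite equivariant_conj.
by apply/ffunP => x; rewrite ffunE.
Qed.

(* The count does not depend on the injection [phi] since conjugation permutes
   all injections transitively; average over them. *)
Lemma card_class_equivariant f s0 phi : injective phi ->
  (#|[set s in s0 ^: [set: {perm T}] | equivariant f s phi]%g| * #|T| ^_ #|V|
   = #|(s0 ^: [set: {perm T}])%g| * #|embeddings f s0|)%N.
Proof.
move=> iphi; set C := (s0 ^: _)%g.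
(* Both sides count pairs of an [s] in the class and an embedding for [s]: the right side groups
   them by [s], the left side by the embedding. *)
have -> : (#|C| * #|embeddings f s0| = \sum_(s in C) #|embeddings f s|)%N.
  rewrite -sum_nat_const; apply: eq_bigr => s /imsetP[g _ ->].
  by rewrite card_embeddings_conj.
rewrite -card_inj_ffuns mulnC -sum_nat_const.
under [RHS]eq_bigr => s _ do rewrite -sum1_card big_mkcond /=.
under [LHS]eq_bigr => psi ipsi.
  have -> : #|[set s in C | equivariant f s phi]|
          = #|[set s in C | equivariant f s psi]|.
    rewrite inE in ipsi; move/injectiveP: ipsi => ipsi.
    by apply/eqP; rewrite eqn_leq !leq_card_class_equivariant.
  over.
under eq_bigr => psi _ do rewrite -sum1_card.
rewrite [RHS]exchange_big /= [LHS]big_mkcond /=; apply: eq_bigr => psi _.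
rewrite inE; case: ifP => ipsi; last first.
  by rewrite big1 // => s _; rewrite inE ipsi.
rewrite -big_mkcondr /=; apply: eq_bigl => s; rewrite !inE ipsi.
by [].
Qed.

Lemma card_embeddings0 f s : (#|T| < #|V|)%N -> #|embeddings f s| = 0%N.
Proof.
move=> lt; apply: eq_card0 => phi; rewrite inE; apply/negP.
by case/andP => /injectiveP/leq_card; rewrite leqNgt lt.
Qed.

End Embeddings.

(** * Counting invariant sets of a permutation *)

Section InvariantSets.
Context {T : finType} (s : {perm T}).
Implicit Types (O S : {set T}) (k : nat).

Definition stabilizes S := [forall x in S, s x \in S].

Definition invariant_sets k : {set {set T}} :=
  [set S : {set T} | stabilizes S && (#|S| == k)].

Lemma stabilizesP S : reflect (forall x, x \in S -> s x \in S) (stabilizes S).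
Proof. exact: forall_inP. Qed.

Lemma porbit_sub x S : stabilizes S -> x \in S -> porbit s x \subset S.
Proof.
move/stabilizesP => inv xS; apply/subsetP => _ /porbitP[i ->].
by elim: i => [|i IHi]; rewrite ?expg0 ?perm1 // expgSr permM inv.
Qed.

(** Since [y] and [s y] lie on the same cycle, [s y] can be in [O] only if [y] is. *)
Lemma stabilizesD_porbit O S : O \in porbits s -> stabilizes S ->
  stabilizes (S :\: O).
Proof.
case/imsetP=> x _ ->{O} /stabilizesP inv; apply/stabilizesP => y.
rewrite !inE => /andP[yO yS]; rewrite inv // andbT.
apply: contra yO; rewrite -!eq_porbit_mem => /eqP <-.
by rewrite eq_porbit_mem porbit_sym -{1}[s y]/((s ^+ 1)%g y) mem_porbit.
Qed.

(** Removing [O] is injective on the sets containing it. The boolean factor matters when [k < #|O|]: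
    there the truncated [k - #|O|] would still count the empty set. *)
Lemma card_invariant_sets_porbit O k : O \in porbits s ->
  (#|[set S in invariant_sets k | O \subset S]|
   <= (#|O| <= k) * #|invariant_sets (k - #|O|)|)%N.
Proof.
move=> sO; case: (leqP #|O| k) => [le|lt]; last first.
  rewrite mul0n leqn0 cards_eq0; apply/eqP/setP => S; rewrite !inE.
  apply/negP => /andP[/andP[_ /eqP cS]] /subset_leq_card.
  by rewrite cS leqNgt lt.
rewrite mul1n -(@card_in_imset _ _ (fun S => S :\: O)) => [|S1 S2].
  apply: subset_leq_card; apply/subsetP => _ /imsetP[S + ->].
  rewrite !inE => /andP[/andP[inv /eqP cS] OS].
  by rewrite stabilizesD_porbit //= cardsD (setIidPr OS) cS.
rewrite !inE => /andP[_ O1] /andP[_ O2] e.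
by rewrite -(setID S1 O) -(setID S2 O) e (setIidPr O1) (setIidPr O2).
Qed.

(** A nonempty invariant set contains the cycle of each of its points, so some [O] accounts for
    it. *)
Lemma leq_card_invariant_sets k : (0 < k)%N ->
  (#|invariant_sets k|
   <= \sum_(O in porbits s) (#|O| <= k) * #|invariant_sets (k - #|O|)|)%N.
Proof.
move=> k0.
apply: (@leq_trans (\sum_(O in porbits s)
    #|[set S in invariant_sets k | O \subset S]|)%N); last first.
  by apply: leq_sum => O /card_invariant_sets_porbit.
under eq_bigr do rewrite -sum1_card big_mkcond /=.
rewrite exchange_big -sum1_card big_mkcond /=; apply: leq_sum => S _.
case: ifP => // SI; have /andP[inv /eqP cS] : stabilizes S && (#|S| == k).
  by rewrite inE in SI.
have /card_gt0P[x xS] : (0 < #|S|)%N by rewrite cS.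
rewrite (bigD1 (porbit s x)) ?imset_f //= inE SI porbit_sub //.
Qed.

End InvariantSets.

Section InvariantBound.
Context {R : realType} {n : nat}.
Implicit Types (s : {perm 'I_n}) (k : nat).

Lemma total_cycles_le s : (total_cycles s <= n)%N.
Proof. by rewrite -{2}[n]card_ord leq_imset_card. Qed.

Lemma total_cycles_gt0 s : (0 < n)%N -> (0 < total_cycles s)%N.
Proof.
case: n s => // n' s _; apply/card_gt0P; exists (porbit s ord0).
exact: imset_f.
Qed.

Lemma sqrt_nat_ge1 c : (0 < c)%N -> 1 <= Num.sqrt c%:R :> R.
Proof. by move=> c0; rewrite -{1}[1]sqrtr1; apply: ler_wsqrtr; rewrite ler1n. Qed.

Lemma cterm_ge1 s : (0 < n)%N -> 1 <= cterm R s.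
Proof.
move=> n0; rewrite -[1]add0r lerD ?ler0n //.
exact/sqrt_nat_ge1/total_cycles_gt0.
Qed.

(** Both summands are at most the number of cycles. Hence [D <= 2 * n], which later turns errors of
    order [1 / n] into errors of order [1 / D]. *)
Lemma cterm_le s : (0 < n)%N -> cterm R s <= 2 * n%:R.
Proof.
move=> n0; have c0 := total_cycles_gt0 s n0; have cn := total_cycles_le s.
have c1 : (cycle_count s 1 <= total_cycles s)%N.
  by apply: subset_leq_card; apply/subsetP => O; rewrite inE => /andP[].
have sq : Num.sqrt (total_cycles s)%:R <= (total_cycles s)%:R :> R.
  rewrite -{2}[_%:R]sqr_sqrtr ?ler0n // expr2 ler_peMr ?sqrtr_ge0 //.
  exact: sqrt_nat_ge1.
rewrite mulr2n mulrDl mul1r lerD // ?ler_nat.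
  exact: leq_trans c1 cn.
by apply: le_trans sq _; rewrite ler_nat.
Qed.

(* A fixed point costs a factor [cycle_count s 1] for one element; any longer
   cycle costs [total_cycles s], the square of the second summand of [cterm],
   for at least two elements. *)
Lemma card_invariant_sets_le s k : (0 < n)%N ->
  #|invariant_sets s k|%:R <= cterm R s ^+ k.
Proof.
move=> n0; set t := cterm R s; have t1 : 1 <= t by exact: cterm_ge1.
have t0 : 0 < t by apply: lt_le_trans t1.
elim/ltn_ind: k => -[_|k IH].
  rewrite expr0 lern1 -(cards1 (set0 : {set 'I_n})); apply: subset_leq_card.
  by apply/subsetP => S; rewrite !inE cards_eq0 => /andP[].
set c : R := (total_cycles s)%:R; have c0 : 1 <= c.
  by rewrite /c ler1n total_cycles_gt0.
have sc0 : 1 <= Num.sqrt c by exact/sqrt_nat_ge1/total_cycles_gt0.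
have sct : Num.sqrt c <= t by rewrite lerDr.
have le := leq_card_invariant_sets s (ltn0Sn k).
rewrite -(ler_nat R) in le; apply: le_trans le _; rewrite natr_sum.
(* Majorant of the summand of [O]. A fixed point leaves [k] elements; a longer cycle leaves at most
   [k - 1], and [Num.sqrt c <= t] pays for the division. Over all [c] cycles the second term adds up
   to [Num.sqrt c * t ^+ k]. *)
pose G (O : {set 'I_n}) : R :=
  (if #|O| == 1%N then t ^+ k else 0) + t ^+ k / Num.sqrt c.
have tk0 : 0 <= t ^+ k by rewrite exprn_ge0 ?ltW.
apply: (@le_trans _ _ (\sum_(O in porbits s) G O)).
  apply: ler_sum => O /imsetP[x _ ->]; rewrite /G.
  have := card_porbit_neq0 s x; case E : #|porbit s x| => [//|[|l]] _ /=.
    rewrite mul1n subn1 /= (le_trans (IH _ _)) //.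
    by rewrite lerDl divr_ge0 ?sqrtr_ge0.
  rewrite add0r; case: (leqP l.+2 k.+1) => [le|_]; last by rewrite divr_ge0 ?sqrtr_ge0.
  rewrite mul1n (le_trans (IH _ _)) //; first by lia.
  rewrite ler_pdivlMr ?(lt_le_trans ltr01) //.
  apply: (@le_trans _ _ (t ^+ (k.+1 - l.+2) * t)).
    by rewrite ler_wpM2l // exprn_ge0 // ltW.
  by rewrite -exprSr ler_weXn2l //; lia.
rewrite big_split /= -big_mkcondr /= !sumr_const.
rewrite (@eq_card _ _ [set O in porbits s | #|O| == 1%N]); last first.
  by move=> O; rewrite inE.
rewrite -!(mulr_natl (_ / _)) -!(mulr_natl (t ^+ k)).
rewrite exprSr mulrC [leRHS]mulrC mulrDl lerD //; first by rewrite mulrC.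
have e : #|porbits s|%:R = Num.sqrt c ^+ 2.
  by rewrite sqr_sqrtr // (le_trans ler01).
rewrite {1}e expr2 -mulrA [_ * (_ / _)]mulrC divfK //.
by rewrite gt_eqF // (lt_le_trans ltr01).
Qed.

End InvariantBound.

(** * Embeddings and their images *)

Section Images.
Context {V T : finType}.
Implicit Types (f : {ffun V -> V}) (s : {perm T}) (phi : {ffun V -> T}).
Implicit Types (S : {set T}).

Lemma image_embedding f s phi : phi \in embeddings f s ->
  phi @: V \in invariant_sets s #|V|.
Proof.
rewrite !inE => /andP[/injectiveP iphi /equivariantP ephi].
rewrite card_imset // eqxx andbT; apply/stabilizesP => _ /imsetP[x _ ->].
by rewrite ephi imset_f.
Qed.

(** An injection into a set of the same size as [V] is onto it. *)
Lemma card_injections_onto S : #|S| = #|V| ->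
  #|[set phi : {ffun V -> T} | injectiveb phi && (phi @: V == S)]| = (#|V|)`!.
Proof.
move=> cS; rewrite -ffactnn -{1}cS -(@card_inj_ffuns_on V T (mem S)).
apply: eq_card => phi; rewrite !inE andbC; apply: andb_id2r => /injectiveP iphi.
apply/eqP/ffun_onP => [<- x|h]; first exact: imset_f.
apply/eqP; rewrite eqEcard card_imset // cS leqnn andbT.
by apply/subsetP => _ /imsetP[x _ ->]; apply: h.
Qed.

(** The image is invariant and arises from at most [#|V|]! injections. The predicate [P] allows for
    counting only images through a given point. *)
Lemma card_embeddings_image f s (P : pred {set T}) :
  (#|[set phi in embeddings f s | P (phi @: V)]|
   <= (#|V|)`! * #|[set S in invariant_sets s #|V| | P S]|)%N.
Proof.
rewrite -sum1_card.
rewrite (partition_big (fun phi : {ffun V -> T} => phi @: V)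
   [in [set S in invariant_sets s #|V| | P S]]) /=; last first.
  by move=> phi /setIdP[/image_embedding + Pphi]; rewrite !inE Pphi => ->.
rewrite mulnC -sum_nat_const; apply: leq_sum => S.
rewrite !inE => /andP[/andP[_ /eqP cS] _].
rewrite -(card_injections_onto cS) sum1_card; apply: subset_leq_card.
apply/subsetP => phi; rewrite !inE unfold_in => /andP[/setIdP[+ _] ->].
by rewrite inE => /andP[->].
Qed.

End Images.

(** * Disjoint unions of patterns and colliding embeddings *)

Section Join.
Context {V W T : finType}.
Implicit Types (f : {ffun V -> V}) (g : {ffun W -> W}) (s : {perm T}).
Implicit Types (phi : {ffun V -> T}) (psi : {ffun W -> T}).

Definition join_map f g : {ffun (V + W) -> (V + W)%type} :=
  [ffun u => match u with inl v => inl (f v) | inr w => inr (g w) end].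

Definition join_fun phi psi : {ffun (V + W) -> T} :=
  [ffun u => match u with inl v => phi v | inr w => psi w end].

Definition disjoint_images phi psi := [forall v, forall w, phi v != psi w].

Lemma disjoint_imagesP phi psi :
  reflect (forall v w, phi v <> psi w) (disjoint_images phi psi).
Proof.
apply: (iffP forallP) => h v; first by move=> w; move/forallP: (h v) => /(_ w)/eqP.
by apply/forallP => w; apply/eqP.
Qed.

Lemma sum_join_fun (F : {ffun (V + W) -> T} -> nat) :
  (\sum_chi F chi = \sum_phi \sum_psi F (join_fun phi psi))%N.
Proof.
rewrite pair_big (reindex (fun p => join_fun p.1 p.2)) //=.
exists (fun chi : {ffun (V + W) -> T} =>
  ([ffun v => chi (inl v)], [ffun w => chi (inr w)])) => [[phi psi] _|chi _] /=.
  by congr pair; apply/ffunP => x; rewrite !ffunE.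
by apply/ffunP => -[v|w]; rewrite !ffunE.
Qed.

Lemma injectiveb_join phi psi : injectiveb (join_fun phi psi) =
  [&& injectiveb phi, injectiveb psi & disjoint_images phi psi].
Proof.
apply/injectiveP/and3P => [inj|[/injectiveP i1 /injectiveP i2 /disjoint_imagesP d]].
  split.
  - apply/injectiveP => x y e; apply/eqP.
    by have := inj (inl x) (inl y); rewrite !ffunE => /(_ e) [->].
  - apply/injectiveP => x y e; apply/eqP.
    by have := inj (inr x) (inr y); rewrite !ffunE => /(_ e) [->].
  - apply/disjoint_imagesP => x y e.
    by have := inj (inl x) (inr y); rewrite !ffunE => /(_ e).
move=> [x|x] [y|y]; rewrite !ffunE.
- by move/i1->.
- by move/d.
- by move/esym/d.
- by move/i2->.
Qed.

Lemma equivariant_join f g s phi psi :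
  equivariant (join_map f g) s (join_fun phi psi)
  = equivariant f s phi && equivariant g s psi.
Proof.
apply/equivariantP/andP => [h|[/equivariantP h1 /equivariantP h2] [v|w]].
- by split; apply/equivariantP => x;
    [have := h (inl x) | have := h (inr x)]; rewrite !ffunE.
- by rewrite !ffunE.
- by rewrite !ffunE.
Qed.

Definition colliding f g s : {set {ffun V -> T} * {ffun W -> T}} :=
  [set p in setX (embeddings f s) (embeddings g s)
     | ~~ disjoint_images p.1 p.2].

(** Two embeddings glue to an embedding of the disjoint union exactly when their images are
    disjoint. *)
Lemma card_embeddings_join f g s :
  (#|embeddings (join_map f g) s| + #|colliding f g s|
   = #|embeddings f s| * #|embeddings g s|)%N.
Proof.
rewrite -cardsX -sum1_card big_mkcond /= sum_join_fun pair_big /=.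
rewrite -[#|colliding _ _ _|]sum1_card [X in (_ + X)%N]big_mkcond -big_split /=.
rewrite -sum1_card [RHS]big_mkcond /=; apply: eq_bigr => -[phi psi] _ /=.
rewrite !inE /= injectiveb_join equivariant_join.
case: (injectiveb phi) => //=; case: (injectiveb psi) => //=.
  by case: (equivariant f s phi); case: (equivariant g s psi);
     case: (disjoint_images phi psi).
by rewrite andbF.
Qed.

(** If [psi] meets [phi] at [phi v], then the image of [psi] is an invariant set through [phi v];
    sum over the possible [v]. *)
Lemma card_colliding_le f g s :
  (#|colliding f g s| <= \sum_(phi in embeddings f s) \sum_v
     (#|W|)`! * #|[set S in invariant_sets s #|W| | phi v \in S]|)%N.
Proof.
rewrite -sum1_card big_mkcond /=.
rewrite (eq_bigr (fun p => if (p.1, p.2) \in colliding f g s then 1 else 0)%N).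
  2: by case.
rewrite -(pair_bigA _ (fun phi psi =>
  if (phi, psi) \in colliding f g s then 1 else 0)%N) /=.
rewrite [leqRHS]big_mkcond; apply: leq_sum => phi _ /=.
case: ifP => ephi; last by rewrite big1 // => psi _; rewrite inE in_setX ephi.
apply: (@leq_trans (\sum_v \sum_(psi in [set psi in embeddings g s |
    phi v \in psi @: W]) 1)%N); last first.
  apply: leq_sum => v _; rewrite sum1_card.
  exact: (card_embeddings_image g s (fun S => phi v \in S)).
under [leqRHS]eq_bigr do rewrite big_mkcond /=.
rewrite [leqRHS]exchange_big /=; apply: leq_sum => psi _.
case: ifP => //; rewrite inE in_setX ephi /= => /andP[epsi].
case/forallPn => v /forallPn[w]; rewrite negbK => /eqP e.
by rewrite (bigD1 v) //= inE epsi e imset_f.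
Qed.

End Join.


Section EmbeddingBound.
Context {R : realType} {n : nat} {V W : finType}.
Implicit Types (s : {perm 'I_n}) (f : {ffun V -> V}) (g : {ffun W -> W}).

Lemma card_embeddings_le f s : (0 < n)%N ->
  #|embeddings f s|%:R <= (#|V|)`!%:R * cterm R s ^+ #|V|.
Proof.
move=> n0; have := card_embeddings_image f s predT.
have setT_id (I : finType) (A : {set I}) : [set x in A | predT x] = A.
  by apply/setP => x; rewrite inE andbT.
rewrite (setT_id _ (invariant_sets _ _)) (_ : [set _ in _ | _] = embeddings f s).
  2: by apply/setP => x; rewrite inE andbT.
rewrite -(ler_nat R) natrM => /le_trans; apply.
by rewrite ler_wpM2l ?ler0n // card_invariant_sets_le.
Qed.

(** Such a set contains the whole cycle of [x]. Removing that cycle takes away at least one element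
    at no cost, which saves one factor [cterm R s]. *)
Lemma card_invariant_sets_mem_le s k x : (0 < n)%N ->
  #|[set S in invariant_sets s k | x \in S]|%:R <= cterm R s ^+ k / cterm R s.
Proof.
move=> n0; have t1 := cterm_ge1 (R := R) s n0.
have t0 : 0 < cterm R s by apply: lt_le_trans t1.
have le : (#|[set S in invariant_sets s k | x \in S]| <= 
   #|[set S in invariant_sets s k | porbit s x \subset S]|)%N.
  apply: subset_leq_card; apply/subsetP => S; rewrite !inE.
  by case/andP => /andP[inv ->] xS; rewrite inv porbit_sub.
have orb : porbit s x \in porbits s by exact: imset_f.
have := leq_trans le (card_invariant_sets_porbit k orb).
rewrite -(ler_nat R) => /le_trans; apply.
have := card_porbit_neq0 s x; case: #|porbit s x| => // l _.
case: (ltnP l k) => lk; last by rewrite mul0n divr_ge0 ?exprn_ge0 ?ltW.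
rewrite mul1n (le_trans (card_invariant_sets_le _ _ n0)) // ler_pdivlMr //.
by rewrite -exprSr ler_weXn2l //; lia.
Qed.

Lemma card_colliding_le_cterm f g s : (0 < n)%N ->
  #|colliding f g s|%:R <= ((#|V|)`! * (#|W|)`! * #|V|)%:R
     * (cterm R s ^+ (#|V| + #|W|) / cterm R s).
Proof.
move=> n0; have t1 := cterm_ge1 (R := R) s n0.
have t0 : 0 < cterm R s by apply: lt_le_trans t1.
have := card_colliding_le f g s; rewrite -(ler_nat R) => /le_trans; apply.
rewrite natr_sum.
have le : 0 <= cterm R s ^+ #|W| / cterm R s by rewrite divr_ge0 ?exprn_ge0 ?ltW.
apply: (@le_trans _ _ (\sum_(phi in embeddings f s)
   (#|V| * (#|W|)`!)%:R * (cterm R s ^+ #|W| / cterm R s))).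
  apply: ler_sum => phi _; rewrite natr_sum natrM -mulrA mulr_natl -sumr_const.
  apply: ler_sum => v _; rewrite natrM ler_wpM2l ?ler0n //.
  exact: card_invariant_sets_mem_le.
rewrite sumr_const -[leLHS]mulr_natl.
apply: le_trans (ler_wpM2r _ (card_embeddings_le f s n0)) _.
  by rewrite mulr_ge0.
rewrite le_eqVlt; apply/orP; left; apply/eqP.
rewrite !natrM exprD; ring.
Qed.

End EmbeddingBound.

Lemma card_set_sum (I : finType) (P Q : pred I) :
  #|[set x | P x && Q x]| = (\sum_(x | P x) Q x)%N.
Proof.
rewrite -sum1_card big_mkcond [RHS]big_mkcond; apply: eq_bigr => x _.
by rewrite inE; case: (P x); case: (Q x).
Qed.

(** * Expected number of realizations of a list of patterns *)

Section Mean.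
Context {n : nat} {V : finType}.
Implicit Types (s t : {perm 'I_n}) (A : {set 'I_n}).
Implicit Types (P : seq ({ffun V -> V} * {ffun V -> V})).

(** The set [A] confines the images, so that blocks can be placed one after another in what the
    earlier ones left free. *)
Definition realizations P A s t : nat :=
  \sum_(p <- P) #|[set phi : {ffun V -> 'I_n} |
    [&& injectiveb phi, [forall x, phi x \in A],
        equivariant p.1 s phi & equivariant p.2 t phi]]|.

(** Closed form of the expectation over the classes of [s] and [t]. If [n < #|V|], numerator and
    denominator vanish and the quotient is 0. *)
Definition mean (R : realType) P s t : R :=
  \sum_(p <- P) (#|embeddings p.1 s| * #|embeddings p.2 t|)%:R
     / (n ^_ #|V|)%:R.

(** By independence, a fixed injection is compatible with both permutations with probability the
    product of the two values given by [card_class_equivariant]. *)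
Lemma Epair_realizations (R : realType) P s0 t0 :
  Epair (conj_class s0) (conj_class t0)
    (fun s t => (realizations P [set: 'I_n] s t)%:R) = mean R P s0 t0.
Proof.
rewrite /Epair /conj_class; set C := (s0 ^: _)%g; set C' := (t0 ^: _)%g.
have C0 : (#|C|%:R != 0 :> R).
  by rewrite pnatr_eq0 -lt0n; apply/card_gt0P; exists s0; apply: class_refl.
have C0' : (#|C'|%:R != 0 :> R).
  by rewrite pnatr_eq0 -lt0n; apply/card_gt0P; exists t0; apply: class_refl.
have -> : \sum_(s in C) \sum_(t in C') (realizations P [set: 'I_n] s t)%:R
  = \sum_(p <- P) \sum_(phi : {ffun V -> 'I_n} | injectiveb phi)
     (#|[set s in C | equivariant p.1 s phi]|
      * #|[set t in C' | equivariant p.2 t phi]|)%:R :> R.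
  under eq_bigr do rewrite -natr_sum.
  under [RHS]eq_bigr do rewrite -natr_sum.
  rewrite -!natr_sum; congr (_%:R).
  under eq_bigr do rewrite exchange_big /=.
  rewrite exchange_big /=; apply: eq_bigr => p _.
  under eq_bigr => s _ do under eq_bigr => t _ do rewrite card_set_sum.
  under eq_bigr do rewrite exchange_big /=.
  rewrite exchange_big /=; apply: eq_bigr => phi _.
  rewrite !card_set_sum big_distrlr; apply: eq_bigr => s _; apply: eq_bigr => t _.
  rewrite (_ : [forall x, _]) /=; last by apply/forallP => x; rewrite inE.
  by rewrite mulnb.
rewrite /mean big_distrl /=; apply: eq_bigr => p _.
have [lt|le] := ltnP n #|V|.
  rewrite card_embeddings0 ?card_ord // mul0n mul0r big1 ?mul0r // => phi.
  by move/injectiveP/leq_card; rewrite card_ord leqNgt lt.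
have N0 : ((n ^_ #|V|)%:R != 0 :> R) by rewrite pnatr_eq0 -lt0n ffact_gt0.
under eq_bigr => phi /injectiveP iphi.
  have e1 := card_class_equivariant p.1 s0 iphi.
  have e2 := card_class_equivariant p.2 t0 iphi.
  rewrite card_ord in e1 e2.
  move/(congr1 (fun m => m%:R : R)): e1; rewrite !natrM => /(canRL (mulfK N0)) ->.
  move/(congr1 (fun m => m%:R : R)): e2; rewrite !natrM => /(canRL (mulfK N0)) ->.
  over.
have card_inj : #|fun phi : {ffun V -> 'I_n} => injectiveb phi| = (n ^_ #|V|)%N.
  have := card_inj_ffuns V 'I_n; rewrite card_ord => <-.
  by apply: eq_card => phi; rewrite !inE.
(* All [n ^_ #|V|] injections contribute equally, which cancels one of the two denominators. *)
rewrite sumr_const card_inj.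
by field; apply/and3P; split.
Qed.

End Mean.

(** * Estimates for falling factorials *)

Lemma ffact_le_exp n v : (n ^_ v <= n ^ v)%N.
Proof.
elim: v => // v IH; rewrite ffactnSr expnSr leq_mul //.
exact: leq_subr.
Qed.

(** Factor by factor, [n <= v * (n - k)] for [k < v], because [d + k <= (k + 1) * d] for
    [d = n - k >= 1]. *)
Lemma exp_le_ffact n v : (v <= n)%N -> (n ^ v <= v ^ v * n ^_ v)%N.
Proof.
move=> vn; suff h k : (k <= v)%N -> (n ^ k <= v ^ k * n ^_ k)%N by exact: h.
elim: k => // k IH kv; rewrite ffactnSr !expnSr mulnACA leq_mul ?(IH (ltnW kv)) //.
have /subnK : (k <= n)%N by lia.
have : (0 < n - k)%N by lia.
move: (n - k)%N => d d0 <-; apply: (@leq_trans (k.+1 * d)%N).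
  by rewrite mulSn leq_add2l leq_pmulr.
by rewrite leq_mul2r kv orbT.
Qed.

Lemma ffactnD n v w : (n ^_ (v + w) = n ^_ v * (n - v) ^_ w)%N.
Proof.
elim: w => [|w IH]; first by rewrite addn0 muln1.
by rewrite addnS !ffactnSr IH subnDA mulnA.
Qed.

Lemma subn_exp_le_ffact m w : ((m - w) ^ w <= m ^_ w)%N.
Proof.
suff h k : (k <= w)%N -> ((m - w) ^ k <= m ^_ k)%N by exact: h.
by elim: k => // k IH kw; rewrite ffactnSr expnSr leq_mul ?(IH (ltnW kw)) //; lia.
Qed.

(** Bernoulli's inequality [(1 - a / n) ^ w >= 1 - w * a / n], cleared of denominators. *)
Lemma exp_sub_le n a w : (a <= n)%N ->
  (n * n ^ w <= n * (n - a) ^ w + w * a * n ^ w)%N.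
Proof.
move=> an; elim: w => [|w IH]; first by rewrite mul0n addn0.
have le : ((n - a) ^ w <= n ^ w)%N.
  by case: w {IH} => // w; rewrite leq_exp2r // leq_subr.
rewrite !expnS; move: (n ^ w)%N ((n - a) ^ w)%N IH le => x y IH le.
have : (n * (n * x) <= n * (n * y + w * a * x))%N by rewrite leq_mul2l IH orbT.
have : (n * a * y <= n * a * x)%N by rewrite leq_mul2l le orbT.
by have /subnK := an; move: (n - a)%N => d <-; nia.
Qed.

(** Bound [n ^_ w] above by [n ^ w] and [(n - v) ^_ w] below by [(n - v - w) ^ w], then apply
    [exp_sub_le] with [a = v + w]. *)
Lemma ffact_shift n v w : (v + w <= n)%N ->
  (n * n ^_ w <= n * (n - v) ^_ w + w * (v + w) * n ^ w)%N.
Proof.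
move=> le; have := exp_sub_le w le; have := subn_exp_le_ffact (n - v) w.
rewrite -subnDA => h1 h2; have := ffact_le_exp n w => h3.
apply: (leq_trans _ (leq_trans h2 _)); first by rewrite leq_mul2l h3 orbT.
by rewrite leq_add2r leq_mul2l h1 orbT.
Qed.

(** * Bounds in terms of [B] and [D] *)

Section JoinMean.
Context {R : realType} {n : nat} (s t : {perm 'I_n}).
Hypothesis n_gt0 : (0 < n)%N.

Local Notation a := (cterm R s).
Local Notation a' := (cterm R t).
Local Notation B := (Bconst R s t).
Local Notation D := (Dconst R s t).

Let a1 : 1 <= a. Proof. exact: cterm_ge1. Qed.
Let a1' : 1 <= a'. Proof. exact: cterm_ge1. Qed.
Let a0 : 0 < a. Proof. exact: lt_le_trans a1. Qed.
Let a0' : 0 < a'. Proof. exact: lt_le_trans a1'. Qed.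
Let n0 : 0 < n%:R :> R. Proof. by rewrite ltr0n. Qed.
Let a_ge0 : 0 <= a. Proof. exact: ltW. Qed.
Let a_ge0' : 0 <= a'. Proof. exact: ltW. Qed.

Lemma Bconst_ge1 : 1 <= B. Proof. by rewrite /Bconst le_max lexx orbT. Qed.

Lemma Dconst_ge1 : 1 <= D. Proof. by rewrite /Dconst le_min a1 a1'. Qed.

Let B0 : 0 < B. Proof. exact: lt_le_trans Bconst_ge1. Qed.
Let B_ge0 : 0 <= B. Proof. exact: ltW. Qed.
Let D0 : 0 < D. Proof. exact: lt_le_trans Dconst_ge1. Qed.
Let Da : D <= a. Proof. by rewrite /Dconst ge_min lexx. Qed.
Let Da' : D <= a'. Proof. by rewrite /Dconst ge_min lexx orbT. Qed.
Let Dn : D <= 2 * n%:R. Proof. exact: le_trans Da (cterm_le s n_gt0). Qed.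

Lemma cterm_pow_le v : (v <= n)%N ->
  a ^+ v * a' ^+ v / (n ^_ v)%:R <= (v ^ v)%:R * B ^+ v.
Proof.
move=> vn; have N0 : 0 < (n ^_ v)%:R :> R by rewrite ltr0n ffact_gt0.
apply: (@le_trans _ _ ((v ^ v)%:R * (a * a' / n%:R) ^+ v)); last first.
  rewrite ler_wpM2l ?ler0n // lerXn2r ?nnegrE ?divr_ge0 ?mulr_ge0 ?ler0n //.
  by rewrite /Bconst le_max lexx.
rewrite expr_div_n exprMn mulrCA ler_wpM2l ?mulr_ge0 ?exprn_ge0 //.
rewrite ler_pdivlMr ?exprn_gt0 // mulrC ler_pdivrMr // -natrX -natrM ler_nat.
exact: exp_le_ffact.
Qed.

(** The factorials come from the two embedding counts, [v ^ v] from comparing [n ^_ v] with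
    [n ^ v]. *)
Definition mean_const v : nat := (v`! * v`! * v ^ v)%N.

Lemma mean_term_le (V : finType) (p : {ffun V -> V} * {ffun V -> V}) :
  (#|embeddings p.1 s| * #|embeddings p.2 t|)%:R / (n ^_ #|V|)%:R
   <= (mean_const #|V|)%:R * B ^+ #|V|.
Proof.
have [lt|le] := ltnP n #|V|.
  rewrite card_embeddings0 ?card_ord // mul0n mul0r mulr_ge0 ?ler0n //.
  by rewrite exprn_ge0.
have N0 : 0 < (n ^_ #|V|)%:R :> R by rewrite ltr0n ffact_gt0.
have e1 : #|embeddings p.1 s|%:R <= _ := card_embeddings_le (R := R) p.1 s n_gt0.
have e2 : #|embeddings p.2 t|%:R <= _ := card_embeddings_le (R := R) p.2 t n_gt0.
rewrite natrM [(mean_const _)%:R]natrM -[leRHS]mulrA.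
apply: (le_trans _ (ler_wpM2l (ler0n _ _) (cterm_pow_le le))).
rewrite [leRHS]mulrA ler_wpM2r ?invr_ge0 ?ler0n // natrM mulrACA.
exact: ler_pM.
Qed.

(** The three summands pay for collisions, for the change of denominator, and for the case
    [n < v + w]. *)
Definition join_const v w : nat :=
  ((2 * (v`! * w`!) ^ 2 * v + 2 * (v`! * w`!) ^ 2 * (w * (v + w) * w ^ w))
     * (v + w) ^ (v + w) + mean_const v * mean_const w * (2 * (v + w)))%N.

(* [E = e * g - d] and [E' = e' * g' - d'] count the embeddings of the joined
   patterns, [d] and [d'] being the numbers of colliding pairs. *)
Lemma join_product_le v w (e e' g g' E E' d d' : R) :
  0 <= e <= v`!%:R * a ^+ v -> 0 <= e' <= v`!%:R * a' ^+ v ->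
  0 <= g <= w`!%:R * a ^+ w -> 0 <= g' <= w`!%:R * a' ^+ w ->
  0 <= E -> 0 <= E' -> E + d = e * g -> E' + d' = e' * g' ->
  0 <= d <= (v`! * w`! * v)%:R * (a ^+ (v + w) / a) ->
  0 <= d' <= (v`! * w`! * v)%:R * (a' ^+ (v + w) / a') ->
  0 <= e * e' * (g * g') - E * E'
    <= (2 * (v`! * w`!) ^ 2 * v)%:R * (a ^+ (v + w) * a' ^+ (v + w)) / D.
Proof.
move=> /andP[e0 le] /andP[e0' le'] /andP[g0 lg] /andP[g0' lg'] E0 E0' eE eE'.
move=> /andP[d0 ld] /andP[d0' ld'].
set F : R := (v`! * w`!)%:R; set x := a ^+ (v + w); set x' := a' ^+ (v + w).
have F0 : 0 <= F by rewrite ler0n.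
have x0 : 0 <= x by rewrite exprn_ge0.
have x0' : 0 <= x' by rewrite exprn_ge0.
have v0 : 0 <= v%:R :> R by rewrite ler0n.
have eg : E <= F * x.
  apply: (@le_trans _ _ (e * g)); first by rewrite -eE lerDl.
  by rewrite /F /x natrM exprD mulrACA ler_pM.
have eg' : e' * g' <= F * x' by rewrite /F /x' natrM exprD mulrACA ler_pM.
(* Changing one factor at a time leaves a single collision count in each summand, and with it a
   division by [a] or [a'], both at least [D]. *)
have -> : e * e' * (g * g') - E * E' = E * d' + d * (e' * g').
  have -> : e * e' * (g * g') = (e * g) * (e' * g') by ring.
  by rewrite -eE -eE'; ring.
have eg0' : 0 <= e' * g' by rewrite mulr_ge0.
rewrite addr_ge0 ?mulr_ge0 //=.
have -> : (2 * (v`! * w`!) ^ 2 * v)%:R * (x * x') / D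
   = (F * x) * (F * v%:R * (x' / D)) + (F * v%:R * (x / D)) * (F * x').
  by rewrite /F !natrM; field; rewrite gt_eqF.
rewrite natrM -/F in ld ld'.
apply: lerD; apply: ler_pM => //.
  apply: le_trans ld' _; rewrite ler_wpM2l ?mulr_ge0 // ler_wpM2l //.
  by rewrite lef_pV2 ?posrE.
apply: le_trans ld _; rewrite ler_wpM2l ?mulr_ge0 // ler_wpM2l //.
by rewrite lef_pV2 ?posrE.
Qed.

(** As [n ^_ (v + w) = n ^_ v * (n - v) ^_ w], the relative error is [1 - (n - v) ^_ w / n ^_ w],
    which [ffact_shift] bounds by a constant over [n]. *)
Lemma inv_ffactD_le v w : (v + w <= n)%N ->
  (0 : R) <= (n ^_ (v + w))%:R^-1 - ((n ^_ v)%:R * (n ^_ w)%:R)^-1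
    <= (2 * (w * (v + w) * w ^ w))%:R / D / (n ^_ (v + w))%:R.
Proof.
move=> le.
have vn : (v <= n)%N := leq_trans (leq_addr _ _) le.
have wn : (w <= n)%N := leq_trans (leq_addl _ _) le.
have Nv : 0 < (n ^_ v)%:R :> R by rewrite ltr0n ffact_gt0.
have Nw : 0 < (n ^_ w)%:R :> R by rewrite ltr0n ffact_gt0.
have Nm : 0 < ((n - v) ^_ w)%:R :> R by rewrite ltr0n ffact_gt0 leq_subRL.
have lm : ((n - v) ^_ w)%:R <= (n ^_ w)%:R :> R.
  rewrite ler_nat !ffact_prod; apply: leq_prod => i _.
  by rewrite leq_sub2r ?leq_subr.
have Du : n%:R * ((n ^_ w)%:R - ((n - v) ^_ w)%:R)
    <= (w * (v + w) * w ^ w)%:R * (n ^_ w)%:R :> R.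
  rewrite mulrBr lerBlDr -!natrM -natrD ler_nat addnC.
  apply: leq_trans (ffact_shift le) _; rewrite leq_add2l -[leqRHS]mulnA.
  by rewrite leq_mul2l exp_le_ffact ?orbT.
have -> : ((n ^_ (v + w))%:R)^-1 - ((n ^_ v)%:R * (n ^_ w)%:R)^-1
   = ((n ^_ w)%:R - ((n - v) ^_ w)%:R) / (n ^_ w)%:R / (n ^_ (v + w))%:R :> R.
  by rewrite ffactnD natrM; field; rewrite ?gt_eqF.
rewrite divr_ge0 ?divr_ge0 ?subr_ge0 ?ler0n //=.
rewrite ler_wpM2r ?invr_ge0 ?ler0n // ler_pdivrMr // mulrAC ler_pdivlMr //.
set m := _ - _ in Du *; have m0 : 0 <= m by rewrite subr_ge0.
rewrite [(2 * _)%:R]natrM; move: Du (ler_wpM2l m0 Dn); lra.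
Qed.
End JoinMean.

Lemma sum_seq_le (R : realType) (I : Type) (r : seq I) (F : I -> R) c :
  (forall i, F i <= c) -> \sum_(i <- r) F i <= (size r)%:R * c.
Proof.
move=> Fc; elim: r => [|i r IH]; first by rewrite big_nil mul0r.
by rewrite big_cons mulrS mulrDl mul1r lerD.
Qed.

(** * The cost of adjoining one block to a pattern *)

Section JoinPatterns.
Context {V W : finType}.
Implicit Types (P : seq ({ffun V -> V} * {ffun V -> V})).
Implicit Types (Q : seq ({ffun W -> W} * {ffun W -> W})).

Definition join_patterns P Q :
    seq ({ffun (V + W) -> (V + W)%type} * {ffun (V + W) -> (V + W)%type}) :=
  [seq (join_map p.1 q.1, join_map p.2 q.2) | p <- P, q <- Q].

(** Disjointness of the two images is absorbed into the set in which the second one may be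
    placed. *)
Lemma realizations_join n P Q (A : {set 'I_n}) s t :
  realizations (join_patterns P Q) A s t =
  (\sum_(p <- P) \sum_(phi : {ffun V -> 'I_n} |
     [&& injectiveb phi, [forall x, phi x \in A],
         equivariant p.1 s phi & equivariant p.2 t phi])
     realizations Q (A :\: phi @: V) s t)%N.
Proof.
rewrite /realizations big_allpairs_dep; apply: eq_bigr => p _.
rewrite [RHS]exchange_big /=; apply: eq_bigr => q _.
rewrite -sum1_card big_mkcond /= sum_join_fun [RHS]big_mkcond /=.
apply: eq_bigr => phi _; case: ifP => h; last first.
  rewrite big1 // => psi _; rewrite inE injectiveb_join !equivariant_join.
  case: ifP => // /and4P[/and3P[i1 i2 d] /forallP f /andP[e1 _] /andP[e2 _]].
  rewrite i1 e1 e2 andbT /= andbT in h; case/negP: h.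
  by apply/forallP => x; have := f (inl x); rewrite ffunE.
have /and4P[i1 f1 e1 e2] := h.
rewrite -sum1_card [RHS]big_mkcond /=; apply: eq_bigr => psi _.
rewrite !inE injectiveb_join !equivariant_join i1 e1 e2 /= -!andbA.
case: (injectiveb psi) => //=; rewrite andbA.
have -> : disjoint_images phi psi && [forall x, join_fun phi psi x \in A]
   = [forall x, psi x \in A :\: phi @: V].
  apply/andP/forallP => [[/disjoint_imagesP d /forallP f] x|f].
    rewrite inE; have := f (inr x); rewrite ffunE => ->; rewrite andbT.
    by apply/imsetP => -[v _ e]; case: (d v x).
  split; first apply/disjoint_imagesP => v w e.
    by have := f w; rewrite inE -e imset_f.
  apply/forallP => -[v|w]; rewrite ffunE; first exact: (forallP f1).
  by have := f w; rewrite inE => /andP[].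
by [].
Qed.

Section Bound.
Context {R : realType} {n : nat} (s t : {perm 'I_n}).
Hypothesis n_gt0 : (0 < n)%N.
Local Notation B := (Bconst R s t).
Local Notation D := (Dconst R s t).

Lemma mean_le (U : finType) (P : seq ({ffun U -> U} * {ffun U -> U})) :
  0 <= mean R P s t <= (size P * mean_const #|U|)%:R * B ^+ #|U|.
Proof.
rewrite sumr_ge0 => [|p _]; last by rewrite divr_ge0 ?ler0n.
rewrite natrM -mulrA sum_seq_le // => p; exact: mean_term_le.
Qed.

Lemma mean_term_join (p : {ffun V -> V} * {ffun V -> V})
    (q : {ffun W -> W} * {ffun W -> W}) :
  `| (#|embeddings (join_map p.1 q.1) s|
        * #|embeddings (join_map p.2 q.2) t|)%:R / (n ^_ (#|V| + #|W|))%:R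
     - (#|embeddings p.1 s| * #|embeddings p.2 t|)%:R / (n ^_ #|V|)%:R
     * ((#|embeddings q.1 s| * #|embeddings q.2 t|)%:R / (n ^_ #|W|)%:R) |
  <= (join_const #|V| #|W|)%:R * B ^+ (#|V| + #|W|) / D :> R.
Proof.
have D1 := Dconst_ge1 (R := R) s t n_gt0; have D0 : 0 < D by apply: lt_le_trans D1.
have B0 : 0 <= B by rewrite (le_trans ler01) ?Bconst_ge1.
set v := #|V|; set w := #|W|.
have [lt|le] := ltnP n (v + w).
  (* The joined pattern has no embedding. The remaining product is bounded by a constant times
     [B ^+ (v + w)], and [D <= 2 * n <= 2 * (v + w)] lets the factor [1 / D] in at constant cost. *)
  rewrite card_embeddings0 ?card_ord ?card_sum // mul0n mul0r sub0r normrN.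
  rewrite ger0_norm ?mulr_ge0 ?invr_ge0 ?ler0n //.
    apply: le_trans (ler_pM _ _ (mean_term_le s t n_gt0 p) (mean_term_le s t n_gt0 q)) _.
  - by rewrite mulr_ge0 ?invr_ge0 ?ler0n.
  - by rewrite mulr_ge0 ?invr_ge0 ?ler0n.
  rewrite -/v -/w mulrACA -exprD -natrM ler_pdivlMr //.
  have Dle : D <= (2 * (v + w))%:R.
    rewrite (le_trans _ (_ : 2 * n%:R <= _)) //.
      by rewrite /Dconst ge_min cterm_le.
    by rewrite natrM ler_wpM2l // ler_nat ltnW.
  apply: le_trans (ler_wpM2l _ Dle) _; first by rewrite mulr_ge0 ?exprn_ge0.
  rewrite mulrAC -natrM ler_wpM2r ?exprn_ge0 // ler_nat.
  by rewrite /join_const leq_addl.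
set e : R := #|embeddings p.1 s|%:R; set e' : R := #|embeddings p.2 t|%:R.
set g : R := #|embeddings q.1 s|%:R; set g' : R := #|embeddings q.2 t|%:R.
set E : R := #|embeddings (join_map p.1 q.1) s|%:R.
set E' : R := #|embeddings (join_map p.2 q.2) t|%:R.
have rat1 (U : finType) (f : {ffun U -> U}) (r : {perm 'I_n}) :
    0 <= (#|embeddings f r|%:R : R) <= (#|U|)`!%:R * cterm R r ^+ #|U|.
  by rewrite ler0n card_embeddings_le.
have prod1 : 0 <= e * e' * (g * g') - E * E'
    <= (2 * (v`! * w`!) ^ 2 * v)%:R
       * (cterm R s ^+ (v + w) * cterm R t ^+ (v + w)) / D.
  apply: (@join_product_le _ _ s t n_gt0 _ _ e e' g g' E E'
    (#|colliding p.1 q.1 s|)%:R (#|colliding p.2 q.2 t|)%:R); try exact: rat1;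
    rewrite ?ler0n ?card_colliding_le_cterm //.
  - by rewrite /E /e /g -natrD -natrM card_embeddings_join.
  - by rewrite /E' /e' /g' -natrD -natrM card_embeddings_join.
have := inv_ffactD_le (R := R) s t n_gt0 le.
set Nu : R := (n ^_ (v + w))%:R; set Nv : R := (n ^_ v)%:R.
set Nw : R := (n ^_ w)%:R => inv1.
have Nu0 : 0 < Nu by rewrite ltr0n ffact_gt0.
rewrite !natrM -/e -/e' -/g -/g' -/E -/E'.
set x := cterm R s ^+ (v + w) in prod1 *.
set x' := cterm R t ^+ (v + w) in prod1 *.
have xB : x * x' / Nu <= ((v + w) ^ (v + w))%:R * B ^+ (v + w).
  exact: cterm_pow_le.
(* The first summand is the loss from collisions, the second the change of denominator. *)
have -> : E * E' / Nu - e * e' / Nv * (g * g' / Nw) =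
   - ((e * e' * (g * g') - E * E') / Nu)
   + e * e' * (g * g') * (Nu^-1 - (Nv * Nw)^-1).
  by rewrite invfM; ring.
apply: le_trans (ler_normD _ _) _; rewrite normrN.
case/andP: prod1 => p0 p1; case/andP: inv1 => i0 i1.
have [e0 el] := andP (rat1 _ p.1 s); have [e0' el'] := andP (rat1 _ p.2 t).
have [g0 gl] := andP (rat1 _ q.1 s); have [g0' gl'] := andP (rat1 _ q.2 t).
rewrite ger0_norm ?divr_ge0 ?ler0n // ger0_norm; last by rewrite !mulr_ge0.
have F2 : e * e' * (g * g') <= ((v`! * w`!) ^ 2)%:R * (x * x').
  have -> : ((v`! * w`!) ^ 2)%:R * (x * x') = (v`!%:R * cterm R s ^+ v)
    * (v`!%:R * cterm R t ^+ v) * ((w`!%:R * cterm R s ^+ w)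
    * (w`!%:R * cterm R t ^+ w)) :> R.
    by rewrite /x /x' !natrM !exprD; ring.
  by apply: ler_pM; rewrite ?mulr_ge0 //; apply: ler_pM.
set K1 : R := (2 * (v`! * w`!) ^ 2 * v)%:R in p1.
set K2 : R := (2 * (w * (v + w) * w ^ w))%:R in i1.
set F : R := ((v`! * w`!) ^ 2)%:R in F2.
apply: (@le_trans _ _ ((K1 + F * K2) * (x * x' / Nu) / D)).
  rewrite [leRHS](_ : _ = K1 * (x * x') / D / Nu + F * (x * x') * (K2 / D / Nu)).
    by apply: lerD; [rewrite ler_wpM2r ?invr_ge0 ?ler0n | apply: ler_pM;
       rewrite ?mulr_ge0].
  by ring.
rewrite ler_wpM2r ?invr_ge0 ?(ltW D0) //.
have KF0 : 0 <= K1 + F * K2 by rewrite addr_ge0 ?mulr_ge0 ?ler0n.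
apply: le_trans (ler_wpM2l KF0 xB) _.
rewrite mulrA ler_wpM2r ?exprn_ge0 // /K1 /K2 /F -natrM -natrD -natrM ler_nat.
rewrite /join_const; apply: leq_trans (leq_addr _ _); rewrite leq_mul2r.
by apply/orP; right; rewrite leq_add2l mulnA [(_ ^ 2 * 2)%N]mulnC.
Qed.

Lemma mean_join P Q :
  `| mean R (join_patterns P Q) s t - mean R P s t * mean R Q s t |
  <= (size P * size Q * join_const #|V| #|W|)%:R * B ^+ (#|V| + #|W|) / D.
Proof.
rewrite /mean big_allpairs_dep mulr_suml -sumrB /= card_sum.
rewrite !natrM -!mulrA; apply: le_trans (ler_norm_sum _ _ _) _.
apply: sum_seq_le => p; rewrite mulr_sumr -sumrB.
apply: le_trans (ler_norm_sum _ _ _) _.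
by apply: sum_seq_le => q; rewrite [leRHS]mulrA mean_term_join.
Qed.

End Bound.
End JoinPatterns.

(** * Orbits of the group generated by two permutations *)

Section Orbits.
Context {n : nat} (s t : {perm 'I_n}).
Implicit Types (O S A : {set 'I_n}) (i a : nat).

Definition closed2 S := stabilizes s S && stabilizes t S.

Lemma orbit_subset x S : closed2 S -> x \in S ->
  orbit 'P <<[set s; t]>>%g x \subset S.
Proof.
case/andP => /stabilizesP invs /stabilizesP invt xS.
have acts : [acts <<[set s; t]>>%g, on S | 'P].
  rewrite gen_subG; apply/subsetP => g; rewrite !inE => /orP[] /eqP ->.
    by apply/subsetP => y yS; rewrite inE; apply: invs.
  by apply/subsetP => y yS; rewrite inE; apply: invt.
by rewrite acts_sub_orbit.
Qed.

Lemma orbit_closed2 x : closed2 (orbit 'P <<[set s; t]>>%g x).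
Proof.
have step g y : g \in [set s; t] -> y \in orbit 'P <<[set s; t]>>%g x ->
    g y \in orbit 'P <<[set s; t]>>%g x.
  move=> gst /orbitP[h hG <-]; apply/orbitP; exists (h * g)%g.
    by rewrite groupM // mem_gen.
  by rewrite actM.
by apply/andP; split; apply/stabilizesP => y; apply: step; rewrite !inE eqxx ?orbT.
Qed.

(** Orbits are the minimal nonempty sets closed under [s] and [t]. This form avoids the generated
    group and so transfers to patterns, whose maps are arbitrary functions. *)
Lemma gen_orbitsP O : reflect
  [/\ O != set0, closed2 O
    & forall S, S \subset O -> S != set0 -> closed2 S -> S = O]
  (O \in gen_orbits s t).
Proof.
apply: (iffP imsetP) => [[x _ ->]|[O0 cO minO]].
  split; first by apply/set0Pn; exists x; apply: orbit_refl.
    exact: orbit_closed2.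
  move=> S SO /set0Pn[y yS] cS; apply/eqP; rewrite eqEsubset SO /=.
  have /orbit_eqP <- := subsetP SO y yS.
  exact: orbit_subset.
have [x xO] := set0Pn _ O0; exists x => //; apply/esym/minO.
- exact: orbit_subset.
- by apply/set0Pn; exists x; apply: orbit_refl.
- exact: orbit_closed2.
Qed.

Definition orbits_in A i : nat :=
  #|[set O in gen_orbits s t | (O \subset A) && (#|O| == i)]|.

Lemma orbits_in_setT i : orbits_in [set: 'I_n] i = Norb s t i.
Proof. by apply: eq_card => O; rewrite !inE subsetT. Qed.

Lemma gen_orbits_disjoint O O' : O \in gen_orbits s t -> O' \in gen_orbits s t ->
  O' != O -> O' :&: O = set0.
Proof.
move=> /imsetP[x _ ->] /imsetP[y _ ->] ne; apply/eqP/set0Pn => -[z].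
rewrite inE => /andP[/orbit_eqP ez /orbit_eqP ez'].
by rewrite -ez -ez' eqxx in ne.
Qed.

(** Orbits are disjoint, so removing the points of [O] destroys no orbit but [O]. *)
Lemma orbits_inD A O i : O \in gen_orbits s t -> O \subset A ->
  orbits_in (A :\: O) i = (orbits_in A i - (i == #|O|))%N.
Proof.
move=> oO OA; rewrite /orbits_in.
pose X := [set O' in gen_orbits s t | (O' \subset A) && (#|O'| == i)].
rewrite -/X.
have -> : (i == #|O|) = (O \in X) by rewrite inE oO OA /= eq_sym.
rewrite [in RHS](cardsD1 O X) addKn. apply: eq_card => O'.
rewrite !inE; case oO' : (O' \in gen_orbits s t); last by rewrite andbF.
rewrite /= subsetD -setI_eq0; case: (eqVneq O' O) => [->|ne] /=.
  have [O0 _ _] := gen_orbitsP _ oO.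
  by rewrite setIid (negPf O0) andbF.
by rewrite (gen_orbits_disjoint oO) // eqxx andbT.
Qed.

End Orbits.

(** * Patterns of a single orbit *)

Section TransitivePatterns.
Context {a : nat}.
Implicit Types (p : {ffun 'I_a -> 'I_a} * {ffun 'I_a -> 'I_a}).

Definition transitive_pattern p := [forall S : {set 'I_a},
  [&& S != set0, [forall x in S, p.1 x \in S] & [forall x in S, p.2 x \in S]]
   ==> (S == [set: 'I_a])].

Definition transitive_patterns := enum transitive_pattern.

Context {n : nat}.
Implicit Types (s t : {perm 'I_n}) (phi : {ffun 'I_a -> 'I_n}).

Lemma invariant_image f s phi (S : {set 'I_a}) :
  injective phi -> equivariant f s phi ->
  stabilizes s (phi @: S) = [forall x in S, f x \in S].
Proof.
move=> iphi /equivariantP e; apply/stabilizesP/forall_inP => h x.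
  by move=> xS; have := h (phi x) (imset_f _ xS); rewrite e mem_imset.
by case/imsetP => y yS ->; rewrite e imset_f // h.
Qed.

(** The only self-map of the block that can make [phi] equivariant; the default [x] occurs only when
    [s (phi x)] leaves the image. *)
Definition pullback s phi : {ffun 'I_a -> 'I_a} :=
  [ffun x => odflt x [pick y | phi y == s (phi x)]].

Lemma equivariant_pullback f s phi : injective phi -> equivariant f s phi ->
  f = pullback s phi.
Proof.
move=> iphi /equivariantP e; apply/ffunP => x; rewrite ffunE.
case: pickP => [y /eqP|/(_ (f x))]; last by rewrite e eqxx.
by rewrite e => /iphi.
Qed.

Lemma pullback_equivariant s phi : stabilizes s (phi @: 'I_a) ->
  equivariant (pullback s phi) s phi.
Proof.
move/stabilizesP => inv; apply/equivariantP => x; rewrite ffunE.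
case: pickP => [y /eqP //|no].
have /imsetP[y _ e] := inv _ (imset_f phi (erefl : x \in 'I_a)).
by have := no y; rewrite e eqxx.
Qed.

(** The injection matches stable subsets of the block with closed subsets of its image, so
    minimality transfers through [gen_orbitsP]. *)
Lemma transitive_pattern_orbit s t phi p : (0 < a)%N -> injective phi ->
  equivariant p.1 s phi -> equivariant p.2 t phi ->
  transitive_pattern p = (phi @: 'I_a \in gen_orbits s t).
Proof.
move=> a0 iphi e1 e2.
have cl (S : {set 'I_a}) : closed2 s t (phi @: S)
    = [forall x in S, p.1 x \in S] && [forall x in S, p.2 x \in S].
  by rewrite /closed2 (invariant_image _ iphi e1) (invariant_image _ iphi e2).
have ET : phi @: 'I_a = phi @: [set: 'I_a].
  by apply/setP => y; apply/imsetP/imsetP => -[x _ ->]; exists x; rewrite ?inE.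
apply/forallP/gen_orbitsP => [tr|[_ _ min] S].
  split.
  - rewrite -card_gt0 card_imset // card_ord //.
  - rewrite ET cl; apply/andP; split; apply/forall_inP => x _; exact: in_setT.
  - move=> S' sub S0 cS'.
    have eS : S' = phi @: (phi @^-1: S').
      apply/setP => y; apply/idP/imsetP => [yS|[x + ->]]; last by rewrite inE.
      have /imsetP[x _ ey] := subsetP sub _ yS; exists x => //.
      by rewrite inE -ey.
    have /implyP := tr (phi @^-1: S'); rewrite -cl -eS cS' andbT => h.
    rewrite eS ET (eqP (h _)) //; apply: contra S0 => /eqP e0.
    by rewrite eS e0 imset0.
apply/implyP => /andP[S0 cS]; rewrite -cl in cS.
have := min (phi @: S); rewrite ET => h.
apply/eqP/(imset_inj iphi)/h => //; first by rewrite imsetS ?subsetT.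
by rewrite imset_eq0.
Qed.

(** An injection onto an orbit is equivariant for exactly one transitive pattern, its pullback, and
    each orbit of size [a] is the image of [a]! injections. *)
Lemma sum_transitive_patterns s t (A : {set 'I_n}) (F : {set 'I_n} -> nat) :
  (0 < a)%N ->
  (\sum_(p <- transitive_patterns) \sum_(phi : {ffun 'I_a -> 'I_n} |
     [&& injectiveb phi, [forall x, phi x \in A],
         equivariant p.1 s phi & equivariant p.2 t phi]) F (phi @: 'I_a)
   = a`! * \sum_(O in gen_orbits s t | (O \subset A) && (#|O| == a)) F O)%N.
Proof.
move=> a0; rewrite big_enum /=.
under eq_bigr do rewrite big_mkcond /=.
rewrite exchange_big /= big_distrr /=.
pose good := [pred phi : {ffun 'I_a -> 'I_n} | injectiveb phi &&
  ((phi @: 'I_a \in gen_orbits s t) && (phi @: 'I_a \subset A))].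
transitivity (\sum_(phi | good phi) F (phi @: 'I_a))%N.
  rewrite [RHS]big_mkcond; apply: eq_bigr => phi _ /=.
  case: (boolP (injectiveb phi)) => [/injectiveP iphi|_] /=; last by rewrite big1.
  have -> : [forall x, phi x \in A] = (phi @: 'I_a \subset A).
    apply/forallP/subsetP => [h _ /imsetP[x _ ->] //|h x].
    by apply/h/imset_f.
  case: (boolP (_ \subset A)) => sub /=; last by rewrite andbF big1.
  rewrite andbT; case: ifP => oO; last first.
    rewrite big1 // => p tp; case: ifP => // /andP[e1 e2].
    have : transitive_pattern p := tp.
    by rewrite (transitive_pattern_orbit a0 iphi e1 e2) oO.
  have /gen_orbitsP[_ /andP[inv_s inv_t] _] := oO.
  have e1 := pullback_equivariant inv_s; have e2 := pullback_equivariant inv_t.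
  rewrite (bigD1 (pullback s phi, pullback t phi)) /=; last first.
    suff: transitive_pattern (pullback s phi, pullback t phi) by [].
    by rewrite (transitive_pattern_orbit
      (p := (pullback s phi, pullback t phi)) a0 iphi e1 e2).
  rewrite e1 e2 big1 ?addn0 // => -[f g] /= /andP[_ ne].
  case: ifP => // /andP[/(equivariant_pullback iphi) ef].
  move=> /(equivariant_pullback iphi) eg.
  by rewrite ef eg eqxx in ne.
rewrite (partition_big (fun phi : {ffun 'I_a -> 'I_n} => phi @: 'I_a)
  (fun O => (O \in gen_orbits s t) && ((O \subset A) && (#|O| == a)))) /=.
  2: by move=> phi /andP[/injectiveP i /andP[-> ->]]; rewrite card_imset ?card_ord /=.
apply: eq_bigr => O /andP[oO /andP[OA /eqP cO]].
rewrite (eq_bigr (fun _ => F O)) => [|phi /andP[_ /eqP -> //]].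
rewrite sum_nat_const; congr (_ * _)%N.
have := @card_injections_onto 'I_a _ O; rewrite !card_ord => <- //.
apply: eq_card => phi; rewrite !inE unfold_in /=.
by case: eqVneq => [->|]; rewrite ?andbF // oO OA !andbT.
Qed.

End TransitivePatterns.
Arguments transitive_patterns a : clear implicits.

(* The number of ways to pick distinct objects of the successive kinds listed
   in [l] when [h i] objects of kind [i] are available. *)
Fixpoint picks (l : seq nat) (h : nat -> nat) : nat :=
  if l is a :: l' then (h a * picks l' (fun i => h i - (i == a)))%N else 1%N.

Lemma eq_picks l h1 h2 : h1 =1 h2 -> picks l h1 = picks l h2.
Proof.
elim: l h1 h2 => //= a l IH h1 h2 e; rewrite e; congr (_ * _)%N.
by apply: IH => i; rewrite e.
Qed.

(** Picking an object of kind [a] matches the recursion [x ^_ m.+1 = x * x.-1 ^_ m] in the factor of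
    [a] and leaves the other factors alone. *)
Lemma picks_ffact l h K : all (ltn^~ K) l ->
  picks l h = (\prod_(i < K) h i ^_ (count_mem (i : nat) l))%N.
Proof.
elim: l h => [|a l IH] h /=; first by rewrite big1.
case/andP => aK lK; rewrite IH // (bigD1 (Ordinal aK)) //=.
rewrite [RHS](bigD1 (Ordinal aK)) //= !eqxx mulnA add1n ffactnS subn1.
congr (_ * _)%N; apply: eq_bigr => i ne.
have -> : (a == i) = false by apply/negbTE; rewrite eq_sym.
by rewrite eq_sym (_ : (a == i) = false) ?subn0 //; apply/negbTE; rewrite eq_sym.
Qed.

(** * Words of orbit sizes and patterns of several orbits *)

Fixpoint words (k m : nat) : seq (seq nat) :=
  if m is m'.+1 then [seq a :: l | a <- index_iota 1 k.+1, l <- words k m']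
  else [:: [::]].

(** Ordered choices of [m] distinct objects of any kind from 1 to [k], sorted by their sequence of
    kinds. *)
Lemma sum_picks_words k m h :
  (\sum_(l <- words k m) picks l h = (\sum_(1 <= i < k.+1) h i) ^_ m)%N.
Proof.
elim: m h => [|m IH] h; first by rewrite /= big_seq1.
rewrite /= big_allpairs_dep /= ffactnS big_distrl /= big_seq [RHS]big_seq.
apply: eq_bigr => a ak; rewrite -big_distrr /= IH.
(* If [h a = 0], both sides vanish; otherwise the truncated subtraction lowers the total by exactly
   one. *)
case: (posnP (h a)) => [->//|ha0]; congr (_ * _ ^_ _)%N.
rewrite [in RHS](bigD1_seq a) ?iota_uniq //= (bigD1_seq a) ?iota_uniq //= eqxx.
rewrite -[in RHS](prednK ha0) subn1; congr (_ + _)%N.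
by apply: eq_bigr => i /negPf ->; rewrite subn0.
Qed.

Lemma exp_sum_words (R : realType) k m (F : nat -> R) :
  \sum_(l <- words k m) \prod_(a <- l) F a = (\sum_(1 <= i < k.+1) F i) ^+ m.
Proof.
elim: m => [|m IH]; first by rewrite /= big_seq1 big_nil.
rewrite /= big_allpairs_dep exprS -IH mulr_suml; apply: eq_bigr => a _.
by rewrite mulr_sumr; apply: eq_bigr => l _; rewrite big_cons.
Qed.

Lemma mem_words k m l : l \in words k m ->
  all (leq 1) l && (sumn l <= k * m)%N.
Proof.
elim: m l => [|m IH] l /=; first by rewrite inE => /eqP ->.
case/allpairsP => -[a l'] /= [+ /IH /andP[p le] ->].
rewrite mem_index_iota /= => /andP[-> ak]; rewrite p mulnS leq_add //.
Qed.

Fixpoint blocks (l : seq nat) : finType :=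
  if l is a :: l' then ('I_a + blocks l')%type : finType else void : finType.

Fixpoint block_patterns (l : seq nat) :
    seq ({ffun blocks l -> blocks l} * {ffun blocks l -> blocks l}) :=
  match l return seq ({ffun blocks l -> blocks l} * {ffun blocks l -> blocks l})
  with
  | [::] => [:: ([ffun x => x], [ffun x => x])]
  | a :: l' => join_patterns (transitive_patterns a) (block_patterns l')
  end.

Lemma card_blocks l : #|blocks l| = sumn l.
Proof.
elim: l => [|a l IH] /=; first by apply: eq_card0; case.
by rewrite card_sum card_ord IH.
Qed.

Definition factorials (l : seq nat) : nat := (\prod_(a <- l) a`!)%N.

(** Extract the first orbit and recurse in its complement within [A]; [factorials l] counts the
    labellings of the chosen orbits. *)
Lemma realizations_block_patterns n l (A : {set 'I_n}) (s t : {perm 'I_n}) :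
  all (leq 1) l ->
  realizations (block_patterns l) A s t
  = (factorials l * picks l (orbits_in s t A))%N.
Proof.
rewrite /factorials; elim: l A => [|a l IH] A /=.
  move=> _; rewrite big_nil /realizations big_seq1.
  rewrite -[RHS](_ : #|{ffun void -> 'I_n}| = _); last by rewrite card_ffun card_void.
  apply: eq_card => phi; rewrite !inE; apply/and4P; split;
    by [apply/injectiveP; case | apply/forallP; case].
case/andP => a0 pl; rewrite realizations_join.
under eq_bigr do under eq_bigr do rewrite IH //.
rewrite (sum_transitive_patterns s t A (fun O => (\prod_(a <- l) a`!) *
  picks l (orbits_in s t (A :\: O)))%N a0).
rewrite big_cons -!mulnA; congr (_ * _)%N.
rewrite (eq_bigr (fun _ => (\prod_(a <- l) a`! *
    picks l (fun i => orbits_in s t A i - (i == a)))%N)); last first.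
  move=> O /and3P[oO OA /eqP cO]; congr (_ * _)%N.
  by apply: eq_picks => i; rewrite orbits_inD // cO.
rewrite sum_nat_cond_const mulnCA; congr (_ * (_ * _))%N.
Qed.

Lemma realizations_transitive_patterns n a (A : {set 'I_n}) (s t : {perm 'I_n}) :
  (0 < a)%N ->
  realizations (transitive_patterns a) A s t = (a`! * orbits_in s t A a)%N.
Proof.
move=> a0; rewrite /realizations.
under eq_bigr do rewrite cardsE -sum1_card.
rewrite (sum_transitive_patterns s t A (fun _ => 1%N) a0) sum1_card.
by congr (_ * _)%N; apply: eq_card => O; rewrite inE.
Qed.

(** * Factorizing the mean over all blocks *)

Section Chain.
Context {R : realType} {n : nat} (s t : {perm 'I_n}).
Local Notation B := (Bconst R s t).
Local Notation D := (Dconst R s t).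

Fixpoint chain_const (l : seq nat) : nat :=
  if l is a :: l' then
    (size (transitive_patterns a) * size (block_patterns l')
       * join_const a (sumn l')
     + size (transitive_patterns a) * mean_const a * chain_const l')%N
  else 0%N.

Lemma mean_block_patterns_nil : mean R (block_patterns [::]) s t = 1.
Proof.
have E (f : {ffun void -> void}) (r : {perm 'I_n}) : #|embeddings f r| = 1%N.
  rewrite (_ : 1%N = #|{ffun void -> 'I_n}|); last by rewrite card_ffun card_void.
  apply: eq_card => phi; rewrite !inE; apply/andP; split;
    by [apply/injectiveP; case | apply/forallP; case].
by rewrite /mean big_seq1 !E card_void divr1.
Qed.

Lemma mean_chain l : (0 < n)%N ->
  `| mean R (block_patterns l) s t
     - \prod_(a <- l) mean R (transitive_patterns a) s t |
  <= (chain_const l)%:R * B ^+ sumn l / D.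
Proof.
move=> n0; elim: l => [|a l IH].
  by rewrite big_nil mean_block_patterns_nil subrr normr0 !mul0r.
have := mean_join (R := R) s t n0 (transitive_patterns a) (block_patterns l).
rewrite big_cons card_ord card_blocks /=.
set m := mean _ (transitive_patterns a) _ _; set x := mean _ (join_patterns _ _) _ _.
set y := mean _ (block_patterns l) _ _ in IH *; set z := \prod_(_ <- _) _ in IH *.
(* The first difference is the cost of adjoining the block [a]; the second is the error for the
   tail, multiplied by the mean of the head. *)
move=> le; have -> : x - m * z = (x - m * y) + m * (y - z) by ring.
apply: le_trans (ler_normD _ _) _.
rewrite natrD mulrDl mulrDl; apply: lerD => //.
have /andP[m0 ml] := mean_le (R := R) s t n0 (transitive_patterns a).
rewrite normrM ger0_norm //; apply: le_trans (ler_pM _ _ ml IH) _ => //.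
by rewrite card_ord natrM exprD !mulrA; lra.
Qed.

End Chain.

(** * Expectations of orbit counts and the final estimates *)

Section Expectation.
Context {R : realType} {n : nat} {C C' : {set {perm 'I_n}}}.

Lemma eq_Epair (f g : {perm 'I_n} -> {perm 'I_n} -> R) :
  (forall s t, f s t = g s t) -> Epair C C' f = Epair C C' g.
Proof.
by move=> e; congr (_ / _); apply: eq_bigr => s _; apply: eq_bigr => t _.
Qed.

Lemma EpairZ c (f : {perm 'I_n} -> {perm 'I_n} -> R) :
  Epair C C' (fun s t => c * f s t) = c * Epair C C' f.
Proof.
rewrite /Epair mulrA; congr (_ / _); rewrite mulr_sumr; apply: eq_bigr => s _.
by rewrite mulr_sumr.
Qed.

Lemma Epair_sum (I : Type) (r : seq I) (f : I -> {perm 'I_n} -> {perm 'I_n} -> R) :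
  Epair C C' (fun s t => \sum_(i <- r) f i s t) = \sum_(i <- r) Epair C C' (f i).
Proof.
rewrite /Epair -mulr_suml; congr (_ / _); rewrite [RHS]exchange_big /=.
by apply: eq_bigr => s _; rewrite [RHS]exchange_big.
Qed.

End Expectation.

Lemma Norb0 (s t : {perm 'I_0}) i : Norb s t i = 0%N.
Proof.
apply: eq_card0 => O; rewrite !inE; apply/negP => /andP[/imsetP[x _ _] _].
by case: x.
Qed.

(** Applied to [D >= 1], this weakens the bound with [D] to the one with [D^(2/3)]. *)
Lemma powR_le_self (R : realType) (x : R) : 1 <= x -> x `^ (2 / 3) <= x.
Proof.
move=> x1; rewrite -{2}[x]powRr1 ?(le_trans ler01) // ler_powR //; lra.
Qed.

Lemma Epair_picks_mean (R : realType) l n (s0 t0 : {perm 'I_n}) :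
  all (leq 1) l ->
  (factorials l)%:R * Epair (conj_class s0) (conj_class t0)
    (fun s t => (picks l (Norb s t))%:R)
  = mean R (block_patterns l) s0 t0.
Proof.
move=> pl; rewrite -Epair_realizations -EpairZ; apply: eq_Epair => s t.
rewrite realizations_block_patterns // natrM; congr (_ * _%:R).
by apply: eq_picks => i; rewrite orbits_in_setT.
Qed.

Lemma Epair_Norb_mean (R : realType) a n (s0 t0 : {perm 'I_n}) : (0 < a)%N ->
  a`!%:R * Epair (conj_class s0) (conj_class t0) (fun s t => (Norb s t a)%:R)
  = mean R (transitive_patterns a) s0 t0.
Proof.
move=> a0; rewrite -Epair_realizations -EpairZ; apply: eq_Epair => s t.
by rewrite realizations_transitive_patterns // natrM orbits_in_setT.
Qed.

Lemma Epair_picks_le (R : realType) l n (s0 t0 : {perm 'I_n}) :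
  all (leq 1) l ->
  `| Epair (conj_class s0) (conj_class t0) (fun s t => (picks l (Norb s t))%:R)
     - \prod_(a <- l)
         Epair (conj_class s0) (conj_class t0) (fun s t => (Norb s t a)%:R) |
  <= (chain_const l)%:R * Bconst R s0 t0 ^+ sumn l / Dconst R s0 t0 `^ (2 / 3).
Proof.
move=> pl; set C := conj_class s0; set C' := conj_class t0; have B1 := Bconst_ge1 (R := R) s0 t0.
have B0 : 0 <= Bconst R s0 t0 by apply: le_trans B1.
(* For [n = 0] also [D = 0], so the right side is 0 and both terms must agree: they are 1 for the
   empty list and 0 otherwise. *)
have [n0|n0] := posnP n.
  suff -> : Epair C C' (fun s t => (picks l (Norb s t))%:R)
     = \prod_(a <- l) Epair C C' (fun s t => (Norb s t a)%:R) :> R.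
    by rewrite subrr normr0 !mulr_ge0 ?invr_ge0 ?powR_ge0 ?exprn_ge0.
  case: l pl => [|a l] pl.
    have := Epair_picks_mean R s0 t0 pl.
    by rewrite mean_block_patterns_nil /factorials !big_nil mul1r.
  have N0 (s t : {perm 'I_n}) : Norb s t a = 0%N by subst n; apply: Norb0.
  (* Zero is written as [0 * 0] for [EpairZ] to pull out a zero factor. *)
  rewrite big_cons (eq_Epair (g := fun s t => 0 * 0)) => [|s t].
    rewrite EpairZ [X in _ = X * _](eq_Epair (g := fun s t => 0 * 0)) => [|s t].
      by rewrite EpairZ !mul0r.
    by rewrite N0 mul0r.
  by rewrite /= N0 !mul0n mul0r.
set E := Epair _ _ _; set F : R := (factorials l)%:R.
have F1 : 1 <= F by rewrite ler1n prodn_gt0 // => i; apply: fact_gt0.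
have D1 := Dconst_ge1 (R := R) s0 t0 n0.
have D0 : 0 < Dconst R s0 t0 by apply: lt_le_trans D1.
apply: (@le_trans _ _ ((chain_const l)%:R * Bconst R s0 t0 ^+ sumn l
   / Dconst R s0 t0)); last first.
  rewrite ler_wpM2l ?mulr_ge0 ?exprn_ge0 // lef_pV2 ?posrE ?powR_gt0 //.
  exact: powR_le_self.
apply: le_trans (mean_chain s0 t0 l n0).
rewrite -Epair_picks_mean // -/E -/F.
have -> : \prod_(a <- l) mean R (transitive_patterns a) s0 t0
   = F * \prod_(a <- l) Epair C C' (fun s t => (Norb s t a)%:R).
  rewrite /F /factorials natr_prod -big_split /= big_seq [RHS]big_seq.
  by apply: eq_bigr => a al; rewrite Epair_Norb_mean //; apply: (allP pl).
(* The number [F >= 1] of labellings scales both terms alike, so dropping it only shrinks the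
   difference. *)
rewrite -mulrBr normrM ger0_norm ?(le_trans ler01) //.
by rewrite ler_peMl.
Qed.

Lemma leq_sum_term N (F : nat -> nat) a :
  (a < N)%N -> (F a <= \sum_(i < N) F i)%N.
Proof. by move=> aN; rewrite (bigD1 (Ordinal aN)) //= leq_addr. Qed.

(** Makes the constant depend on [M] alone. A positive head leaves a tail of smaller sum, and the
    recursion for [chain_const] also involves the number of patterns of the tail, so both are
    bounded together. *)
Lemma chain_const_bounded M : exists c : nat, forall l,
  all (leq 1) l -> (sumn l <= M)%N ->
  (chain_const l <= c)%N && (size (block_patterns l) <= c)%N.
Proof.
elim: M => [|M [c hc]].
  by exists 1%N => -[|a l] //= /andP[a0 _]; rewrite leqn0 addn_eq0 -leqn0 leqNgt a0.
pose S := (\sum_(a < M.+2) size (transitive_patterns a))%N.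
pose J := (\sum_(a < M.+2) \sum_(b < M.+1) join_const a b)%N.
pose K := (\sum_(a < M.+2) mean_const a)%N.
exists (S * c * J + S * K * c + S * c + 1)%N => -[|a l] /=.
  by rewrite addn1 leq0n.
case/andP => a0 pl sl.
have aM : (a < M.+2)%N by rewrite ltnS (leq_trans (leq_addr _ _) sl).
have lM : (sumn l < M.+1)%N.
  by rewrite ltnS -ltnS (leq_trans _ sl) // -{1}[sumn l]add0n ltn_add2r.
have /andP[cl sz] := hc l pl lM.
have Sa : (size (transitive_patterns a) <= S)%N.
  exact: (leq_sum_term (fun a => size (transitive_patterns a)) aM).
have Ka : (mean_const a <= K)%N by exact: leq_sum_term.
have Ja : (join_const a (sumn l) <= J)%N.
  apply: leq_trans (leq_sum_term (join_const a) lM) _.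
  exact: (leq_sum_term (fun a => \sum_(b < M.+1) join_const a b)%N aM).
rewrite size_allpairs; apply/andP; split.
  by rewrite -addnA (leq_trans _ (leq_addr _ _)) // leq_add ?leq_mul.
by rewrite addn1 ltnW // ltnS (leq_trans _ (leq_addl _ _)) // leq_mul.
Qed.

Theorem theorem3p9 (R : realType) :
  (forall M : nat, exists CM : R,
     forall (k : nat) (m : 'I_k -> nat),
       (0 < k)%N -> (\sum_(i < k) m i * i.+1)%N = M ->
       forall (n : nat) (s0 t0 : {perm 'I_n}),
         let C := conj_class s0 in let C' := conj_class t0 in
         `| Epair C C' (fun s t => \prod_(i < k) ((Norb s t i.+1) ^_ (m i))%:R)
            - \prod_(i < k) (Epair C C' (fun s t => (Norb s t i.+1)%:R)) ^+ (m i) |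
         <= CM * Bconst R s0 t0 ^+ M / Dconst R s0 t0 `^ (2 / 3))
  /\
  (forall k m : nat, (0 < k)%N -> (0 < m)%N -> exists Ckm : R,
     forall (n : nat) (s0 t0 : {perm 'I_n}),
       let C := conj_class s0 in let C' := conj_class t0 in
       let Nle := fun s t => (\sum_(1 <= i < k.+1) Norb s t i)%N in
       `| Epair C C' (fun s t => ((Nle s t) ^_ m)%:R)
          - (Epair C C' (fun s t => (Nle s t)%:R)) ^+ m |
       <= Ckm * Bconst R s0 t0 ^+ (k * m) / Dconst R s0 t0 `^ (2 / 3)).
Proof.
split=> [M|k m _ _].
  have [c hc] := chain_const_bounded M; exists c%:R => k m _ sM n s0 t0; cbv zeta.
  set C := conj_class s0; set C' := conj_class t0.
  (* The list of orbit sizes with [i.+1] repeated [m i] times, the shift being due to ['I_k]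
     starting at 0. *)
  pose l := flatten [seq nseq (m i) i.+1 | i <- enum 'I_k].
  have l_ge1 : all (leq 1) l.
    by apply/allP => _ /flatten_mapP[i _ /nseqP[-> _]].
  have l_lt : all (ltn^~ k.+1) l.
    by apply/allP => _ /flatten_mapP[i _ /nseqP[-> _]]; apply: ltn_ord.
  have l_sum : sumn l = M.
    rewrite -sM sumn_flatten -map_comp sumnE big_map big_enum /=.
    by apply: eq_bigr => i _; rewrite sumn_nseq mulnC.
  have l_count (i : 'I_k) : count_mem i.+1 l = m i.
    rewrite count_flatten -map_comp sumnE big_map big_enum /= (bigD1 i) //=.
    rewrite count_nseq /= eqxx mul1n big1 ?addn0 // => j ji.
    by rewrite count_nseq /= eqSS (inj_eq val_inj) (negPf ji).
  have := Epair_picks_le R s0 t0 l_ge1; rewrite /= l_sum.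
  rewrite big_flatten big_map big_enum /=.
  under [X in _ - X]eq_bigr do rewrite big_nseq iter_mulr_1.
  rewrite (eq_Epair (g := fun s t => \prod_(i < k) (Norb s t i.+1 ^_ m i)%:R));
    last first.
    (* The product in [picks_ffact] starts at size 0, which does not occur in [l]; the other indices
       become [i.+1]. *)
    move=> s t; rewrite (picks_ffact _ l_lt) big_ord_recl /= natrM natr_prod.
    have -> : count_mem 0%N l = 0%N.
      by apply/count_memPn/negP => /(allP l_ge1).
    by rewrite ffactn0 mul1r; apply: eq_bigr => i _; rewrite l_count.
  move=> /le_trans; apply; rewrite ler_wpM2r ?invr_ge0 ?powR_ge0 //.
  rewrite ler_wpM2r ?exprn_ge0 ?(le_trans ler01) ?Bconst_ge1 //.
  by have /andP[h _] := hc l l_ge1 (eq_leq l_sum); rewrite ler_nat.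
(* Expand both the falling factorial and the power over words of length [m]; each word contributes
   its own error. *)
exists (\sum_(l <- words k m) (chain_const l)%:R) => n s0 t0; cbv zeta.
set C := conj_class s0; set C' := conj_class t0.
pose Nle s t := (\sum_(1 <= i < k.+1) @Norb n s t i)%N.
have -> : Epair C C' (fun s t => (Nle s t ^_ m)%:R) =
    \sum_(l <- words k m) Epair C C' (fun s t => (picks l (Norb s t))%:R) :> R.
  rewrite -Epair_sum; apply: eq_Epair => s t.
  by rewrite -natr_sum sum_picks_words.
have -> : Epair C C' (fun s t => (Nle s t)%:R) =
    \sum_(1 <= i < k.+1) Epair C C' (fun s t => (Norb s t i)%:R) :> R.
  by rewrite -Epair_sum; apply: eq_Epair => s t; rewrite natr_sum.
rewrite -exp_sum_words -sumrB; apply: le_trans (ler_norm_sum _ _ _) _.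
rewrite !mulr_suml big_seq [leRHS]big_seq; apply: ler_sum => l /mem_words.
case/andP => pl le; apply: le_trans (Epair_picks_le R s0 t0 pl) _.
(* A word has sum at most [k * m], and [B >= 1] raises the exponent to [k * m]. *)
rewrite ler_wpM2r ?invr_ge0 ?powR_ge0 // ler_wpM2l //.
by rewrite ler_weXn2l ?Bconst_ge1.
Qed.
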